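(* Let $f:\mathbb{R}^n\to\mathbb{R}^n$ be locally Lipschitz and consider the dynamical system $\dot x=f(x)$. Let $h:\mathbb{R}^n\to\mathbb{R}$ be continuously differentiable and let $\mathcal{C}\subset\mathbb{R}^n$ be a nonempty, compact set such that $$\mathcal{C}=\{x\in\mathbb{R}^n: h(x)\ge 0\},\quad \partial\mathcal{C}=\{x\in\mathbb{R}^n: h(x)=0\},\quad \mathrm{Int}(\mathcal{C})=\{x\in\mathbb{R}^n: h(x)>0\}.$$ If $\mathcal{C}$ is forward invariant with respect to $\dot x=f(x)$, then $h|_{\mathcal{C}}$ is a zeroing barrier function defined on $\mathcal{C}$; that is, there exists an extended class $\mathcal{K}$ function $\alpha$ such that $L_fh(x)\ge-\alpha(h(x))$ for all $x\in\mathcal{C}$.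
   Context: $\mathrm{Int}(\mathcal{C})$ and $\partial\mathcal{C}$ denote the interior and boundary of $\mathcal{C}$. A continuous function $\alpha:(-b,a)\to(-\infty,\infty)$, for some $a,b>0$ (possibly infinite), is of extended class $\mathcal{K}$ if it is strictly increasing and $\alpha(0)=0$. Whenever $\alpha(s)$ is written, $s$ is understood to lie in the domain of $\alpha$. $L_fh(x)=\frac{\partial h}{\partial x}(x)f(x)$ is the Lie derivative. Zeroing barrier function (ZBF) for $\mathcal{C}$ defined on a set $\mathcal{D}$ with $\mathcal{C}\subseteq\mathcal{D}\subset\mathbb{R}^n$: there exists an extended class $\mathcal{K}$ function $\alpha$ such that $L_fh(x)\ge-\alpha(h(x))$ for all $x\in\mathcal{D}$. Here $\mathcal{D}=\mathcal{C}$. For $x_0\in\mathbb{R}^n$, let $I(x_0)=[t_0,\tau_{\max})$ be the maximal interval of existence of the unique solution $x(t)$ of $\dot x=f(x)$ with $x(t_0)=x_0$. A set $\mathcal{S}$ is (forward) invariant if for every $x_0\in\mathcal{S}$, $x(t)\in\mathcal{S}$ for all $t\in I(x_0)$. *)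

(* Defs.v *)
(* R^n is 'rV[R]_n, whose (sup) norm induces the usual
   topology. *)
From HB Require Import structures.
From mathcomp Require Export all_boot all_order all_algebra.
From mathcomp Require Export all_classical all_reals all_analysis.
Export Order.TTheory GRing.Theory Num.Theory.
Export numFieldNormedType.Exports.

Set Implicit Arguments.
Unset Strict Implicit.
Unset Printing Implicit Defensive.

Local Open Scope classical_set_scope.
Local Open Scope ring_scope.

Definition boundary (T : topologicalType) (A : set T) : set T :=
  closure A `\` A°.

(* The library's [locally [lipschitz f x | x in setT]] is not used: it
   quantifies over neighbourhoods of all pairs (x, y), not of points. *)
Definition locally_lipschitz (R : realType) (V W : normedModType R)
    (f : V -> W) : Prop :=
  forall x : V, exists2 U : set V, nbhs x U & [lipschitz f y | y in U].

(* In finite dimension, pointwise continuity of x |-> 'd h x is continuity of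
   all the partial derivatives. *)
Definition continuously_differentiable (R : realType) (n : nat)
    (h : 'rV[R]_n -> R) : Prop :=
  (forall x, differentiable h x) /\
  (forall v : 'rV[R]_n, continuous (fun x => 'd h x v)).

Definition lie_derivative (R : realType) (n : nat)
    (f : 'rV[R]_n -> 'rV[R]_n) (h : 'rV[R]_n -> R) (x : 'rV[R]_n) : R :=
  'd h x (f x).

(* Only the values of alpha on ]-b, a[ matter. *)
Definition K_domain (R : realType) (b a : \bar R) : set R :=
  [set s : R | (- b < s%:E)%E /\ (s%:E < a)%E].

Definition extended_class_K (R : realType) (b a : \bar R) (alpha : R -> R) :
    Prop :=
  [/\ (0 < b)%E,
      (0 < a)%E,
      {within K_domain b a, continuous alpha},
      (forall s t, K_domain b a s -> K_domain b a t ->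
        s < t -> alpha s < alpha t)
    & alpha 0 = 0].

(* The membership h x \in ]-b, a[ makes alpha (h x) meaningful. *)
Definition zeroing_barrier_function (R : realType) (n : nat)
    (f : 'rV[R]_n -> 'rV[R]_n) (h : 'rV[R]_n -> R)
    (C D : set 'rV[R]_n) : Prop :=
  C `<=` D /\
  exists (b a : \bar R) (alpha : R -> R),
    extended_class_K b a alpha /\
    forall x, D x ->
      K_domain b a (h x) /\ lie_derivative f h x >= - alpha (h x).

(* Classical solution of x' = f x on [t0, tau[ with x t0 = x0, where tau may be
   +oo; the derivative at t0 is the right one, and the values of x outside
   [t0, tau[ are irrelevant. *)
Definition solution_on (R : realType) (n : nat) (f : 'rV[R]_n -> 'rV[R]_n)
    (t0 : R) (x0 : 'rV[R]_n) (tau : \bar R) (x : R -> 'rV[R]_n) : Prop :=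
  [/\ (t0%:E < tau)%E,
      x t0 = x0,
      (fun t => (t - t0)^-1 *: (x t - x t0)) @ t0^'+ --> f (x t0)
    & forall t : R, t0 < t -> (t%:E < tau)%E ->
        is_derive t (1 : R) x (f (x t))].

(* No solution properly extends x to the right of tau. *)
Definition maximal_solution (R : realType) (n : nat)
    (f : 'rV[R]_n -> 'rV[R]_n)
    (t0 : R) (x0 : 'rV[R]_n) (tau : \bar R) (x : R -> 'rV[R]_n) : Prop :=
  solution_on f t0 x0 tau x /\
  forall (tau' : \bar R) (y : R -> 'rV[R]_n),
    solution_on f t0 x0 tau' y ->
    (forall t : R, t0 <= t -> (t%:E < tau)%E -> y t = x t) ->
    (tau' <= tau)%E.

Definition forward_invariant (R : realType) (n : nat)
    (f : 'rV[R]_n -> 'rV[R]_n) (t0 : R) (S : set 'rV[R]_n) : Prop :=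
  forall x0, S x0 ->
  forall (tau_max : \bar R) (x : R -> 'rV[R]_n),
    maximal_solution f t0 x0 tau_max x ->
    forall t : R, t0 <= t -> (t%:E < tau_max)%E -> S (x t).

(* Main.v *)
(* If h x0 = 0 and L_f h (x0) < 0, the maximal solution starting at x0 has right
   derivative f x0, so h becomes negative along it at once, against forward
   invariance; hence L_f h >= 0 where h = 0.  Compactness then gives, for each
   e > 0, a slope k with - L_f h <= e + k h on C.  The infimum of all affine
   functions c + k s with - L_f h <= c + k h on C vanishes and is continuous at
   s = 0, and is nondecreasing and subadditive, hence continuous; adding s
   makes it strictly increasing.
   The existence of solutions is Peano's theorem: Euler polygons satisfy
   |x t - x s - (t - s) f (x s)| <= L M (t - s)^2 up to an error vanishing with
   the step, and this passes to pointwise limits and yields differentiability.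
   Zorn's lemma extends a local solution to a maximal one. *)
Require Import Defs.
From mathcomp Require Import lra.

Set Implicit Arguments.
Unset Strict Implicit.
Unset Printing Implicit Defensive.

Local Open Scope classical_set_scope.
Local Open Scope ring_scope.

(** * A class K majorant on a compact set *)

(** Where [psi x < e], every [k >= 0] works near [x]; where [psi x >= e > 0], the sign condition
    forces [h x > 0], so large slopes work near [x]. Compactness makes the threshold for [k]
    uniform. *)
Lemma affine_majorant (R : realType) (T : topologicalType) (C : set T)
    (h psi : T -> R) (e : R) :
  compact C -> continuous h -> continuous psi ->
  (forall x, C x -> 0 <= h x) -> (forall x, C x -> h x = 0 -> psi x <= 0) ->
  0 < e -> exists2 k, 0 <= k & forall x, C x -> psi x <= e + k * h x.
Proof.
move=> Cc ch cpsi h0 psi0 e0.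
have /compact_near_coveringP cov := Cc.
have : \forall k \near +oo, C `<=` (fun x => C x -> psi x <= e + k * h x).
  apply: cov => x Cx.
  have [psie|epsi] := ltP (psi x) e.
    near=> y k => /= Cy.
    have k0 : 0 <= k.
    by near: k; apply: nbhs_pinfty_ge; exact: num_real.
    have : psi y < e by near: y; exact: (cvgr_lt (psi x) (cpsi x)).
    have := mulr_ge0 k0 (h0 _ Cy); lra.
  have hx0 : 0 < h x.
    rewrite lt_neqAle h0// andbT; apply/eqP => /esym/(psi0 _ Cx); lra.
  near=> y k => /= Cy.
  (* The threshold comes from [psi y < psi x + 1] and [h y > h x / 2] near [x]. *)
  have hk : (psi x + 1) * 2 / h x <= k.
    by near: k; apply: nbhs_pinfty_ge; exact: num_real.
  have : psi y < psi x + 1.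
    by near: y; apply: (cvgr_lt (psi x) (cpsi x)); rewrite ltrDl.
  have hy : h x / 2 < h y.
    near: y; apply: (cvgr_gt (h x) (ch x)).
    by rewrite ltr_pdivrMr// ltr_pMr// ltr1n.
  move: hk; rewrite ler_pdivrMr// => hk.
  have k0 : 0 <= k by rewrite -(pmulr_lge0 _ hx0); lra.
  have : k * (h x / 2) <= k * h y by rewrite ler_wpM2l// ltW.
  lra.
move=> [M [_ Mk]]; exists (Num.max 0 (M + 1)); first by rewrite le_max lexx.
by move=> x Cx; apply: Mk => //; rewrite lt_max ltrDl ltr01 orbT.
Unshelve. all: by end_near. Qed.

(** For [s <= t <= s + d] one has [a s <= a t <= a s + a d], so smallness of [a d] gives continuity
    everywhere. *)
Lemma subadditive_continuous (R : realType) (a : R -> R) :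
  {homo a : s t / s <= t} -> (forall s t, 0 <= t -> a (s + t) <= a s + a t) ->
  (forall e, 0 < e -> exists2 d, 0 < d & a d <= e) ->
  continuous a.
Proof.
move=> amono asub a0 s; apply/cvgrPdist_le => e /a0[d d0 ade].
near=> t.
have dst : `|s - t| <= d.
  by near: t; have /cvgrPdist_le := @cvg_id _ (nbhs s); apply.
have H u v : u <= v -> v <= u + d -> a v <= a u + e.
  move=> uv vu; apply: (le_trans (amono _ _ vu)).
  by apply: (le_trans (asub _ _ (ltW d0))); rewrite lerD2l.
move: dst; rewrite !ler_norml => /andP[d1 d2].
have [st|/ltW ts] := leP s t.
  have := H s t st; have := amono _ _ st => p q; apply/andP; split; last lra.
  have := q ltac:(lra); lra.
have := H t s ts; have := amono _ _ ts => p q; apply/andP; split; first lra.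
have := q ltac:(lra); lra.
Unshelve. all: by end_near. Qed.

Lemma class_K_majorant (R : realType) (T : topologicalType) (C : set T)
    (h psi : T -> R) :
  compact C -> continuous h -> continuous psi ->
  (forall x, C x -> 0 <= h x) -> (forall x, C x -> h x = 0 -> psi x <= 0) ->
  exists2 alpha, extended_class_K +oo%E +oo%E alpha &
    forall x, C x -> psi x <= alpha (h x).
Proof.
move=> Cc ch cpsi h0 psi0.
pose E : set (R * R) := [set l | [/\ 0 <= l.1, 0 <= l.2 &
  forall x, C x -> psi x <= l.1 + l.2 * h x]].
(* The positive part keeps the affine functions nonnegative and nondecreasing on the whole line, so
   that the infimum exists at negative [s] too. *)
pose p (s : R) : R := Num.max s 0.
pose V s : set R := [set l.1 + l.2 * p s | l in E].
pose a s := inf (V s).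
have p0 s : 0 <= p s by rewrite le_max lexx orbT.
have Ee e : 0 < e -> exists2 k, 0 <= k & E (e, k).
  move=> e0; have [k k0 H] := affine_majorant Cc ch cpsi h0 psi0 e0.
  by exists k => //; split => //=; exact: ltW.
have V0 s : V s !=set0.
  by have [k _ Ek] := Ee 1 ltr01; exists (1 + k * p s), (1, k).
have lbV s : lbound (V s) 0.
  by move=> _ [[c k] [/= c0 k0 _] <-]; rewrite addr_ge0// mulr_ge0.
have aE s l : E l -> a s <= l.1 + l.2 * p s.
  by move=> El; apply: ge_inf; [exists 0; exact: lbV|exists l].
have aP s y : (forall l, E l -> y <= l.1 + l.2 * p s) -> y <= a s.
  by move=> H; apply: lb_le_inf => // _ [l El <-]; exact: H.
have a_ge0 s : 0 <= a s by apply: lb_le_inf.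
have pmono s t : s <= t -> p s <= p t.
  by move=> st; rewrite /p ge_max !le_max st lexx !orbT.
have amono : {homo a : s t / s <= t}.
  move=> s t st; apply: (aP) => l El; apply: (le_trans (aE s l El)).
  by rewrite lerD2l ler_wpM2l ?pmono//; case: El.
have psub s t : 0 <= t -> p (s + t) <= p s + p t.
  move=> t0; rewrite /p (max_idPl t0) ge_max; apply/andP; split.
    by rewrite lerD2r le_max lexx.
  exact: addr_ge0 (p0 s) t0.
have asub s t : 0 <= t -> a (s + t) <= a s + a t.
  move=> t0; rewrite -lerBlDr; apply: (aP) => -[c k] El.
  rewrite lerBlDr -lerBlDl; apply: (aP) => -[c' k'] El'; rewrite lerBlDl /=.
  have [c0 k0 _] := El; have [c0' k0' _] := El'.
  have P := psub s t t0.
  (* Of the two competitors, the one with the smaller slope bounds [a (s + t)]: enlarging its slope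
     on one of the two summands and adding the other constant, which is nonnegative, gives the
     required sum. *)
  have [kk|/ltW kk] := leP k k'.
    apply: (le_trans (aE _ _ El)) => /=.
    have := ler_wpM2l k0 P; have := ler_wpM2r (p0 t) kk.
    move: c0 c0' => /=; lra.
  apply: (le_trans (aE _ _ El')) => /=.
  have := ler_wpM2l k0' P; have := ler_wpM2r (p0 s) kk.
  move: c0 c0' => /=; lra.
have acont : continuous a.
  apply: subadditive_continuous => // e e0.
  have [k k0 Ek] := Ee (e / 2) ltac:(lra).
  exists (e / 2 / (k + 1)); first by rewrite divr_gt0; lra.
  apply: (le_trans (aE _ _ Ek)) => /=.
  rewrite /p (max_idPl _); last by rewrite divr_ge0; lra.
  suff : k * (e / 2 / (k + 1)) <= e / 2 by lra.
  by rewrite mulrA ler_pdivrMr; [rewrite mulrDr mulr1 mulrC lerDl; lra|lra].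
have a00 : a 0 = 0.
  apply/eqP; rewrite eq_le a_ge0 andbT; apply/ler_addgt0Pl => e e0.
  have [k k0 Ek] := Ee e e0.
  by have := aE 0 _ Ek; rewrite /= /p maxxx mulr0 !addr0.
exists (fun s => s + a s).
  split=> //; last by rewrite a00 addr0.
    by apply: continuous_subspaceT => s; apply: cvgD; [exact: cvg_id|exact: acont].
  by move=> s t _ _ st; rewrite ltr_leD// amono// ltW.
move=> x Cx; suff : psi x <= a (h x) by have := h0 x Cx; lra.
by apply: (aP) => l [_ _ /(_ x Cx)]; rewrite /p (max_idPl _)// h0.
Qed.

(** * Estimates for the Euler scheme *)

Definition euler (R : realType) (V : normedModType R) (f : V -> V) (x0 : V)
  (d : R) (k : nat) : V := iter k (fun y => y + d *: f y) x0.

(** The speed bound [M] keeps the Euler scheme inside the ball as long as the elapsed time times [M]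
    is at most [r]; all later estimates are confined to such times. *)
Definition tame_on_ball (R : realType) (V : normedModType R) (f : V -> V)
    (x0 : V) (r M L : R) : Prop :=
  [/\ 0 <= M, 0 <= L, forall u, `|u - x0| <= r -> `|f u| <= M &
   forall u v, `|u - x0| <= r -> `|v - x0| <= r -> `|f u - f v| <= L * `|u - v|].

Lemma euler_ball (R : realType) (V : normedModType R) (f : V -> V)
    (x0 : V) (r M L d : R) (k : nat) :
  tame_on_ball f x0 r M L -> 0 < d -> k%:R * d * M <= r ->
  `|euler f x0 d k - x0| <= k%:R * d * M.
Proof.
move=> [M0 L0 fM fL] d0; elim: k => [|k IH] kr; first by rewrite subrr normr0 !mul0r.
have dM : 0 <= d * M by rewrite mulr_ge0// ltW.
have kr' : k%:R * d * M <= r by move: kr; rewrite -natr1; lra.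
have {IH} Hk := IH kr'.
rewrite /= -/(euler f x0 d k) addrAC (le_trans (ler_normD _ _))//.
rewrite normrZ (gtr0_norm d0) -natr1 !mulrDl mul1r lerD//.
by rewrite ler_pM2l// fM// (le_trans Hk).
Qed.

Lemma euler_lipschitz (R : realType) (V : normedModType R) (f : V -> V)
    (x0 : V) (r M L d : R) (j m : nat) :
  tame_on_ball f x0 r M L -> 0 < d -> (j + m)%:R * d * M <= r ->
  `|euler f x0 d (j + m) - euler f x0 d j| <= m%:R * d * M.
Proof.
move=> tm d0; have [M0 L0 fM fL] := tm.
elim: m => [|m IH] kr; first by rewrite addn0 subrr normr0 !mul0r.
have dM : 0 <= d * M by rewrite mulr_ge0// ltW.
have kr' : (j + m)%:R * d * M <= r by move: kr; rewrite addnS -natr1; lra.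
have {IH} Hk := IH kr'.
rewrite addnS /= -/(euler f x0 d _) addrAC (le_trans (ler_normD _ _))//.
rewrite normrZ (gtr0_norm d0) -natr1 !mulrDl mul1r lerD//.
rewrite ler_pM2l// fM// (le_trans _ kr')//.
exact: euler_ball tm _ _.
Qed.

(** Each further step adds an error [d *: (f y - f z)], and [y] is within [m%:R * d * M] of [z]; the
    Lipschitz bound then makes the accumulated error quadratic in the elapsed time. *)
Lemma euler_tangent (R : realType) (V : normedModType R) (f : V -> V)
    (x0 : V) (r M L d : R) (j m : nat) :
  tame_on_ball f x0 r M L -> 0 < d -> (j + m)%:R * d * M <= r ->
  `|euler f x0 d (j + m) - euler f x0 d j - (m%:R * d) *: f (euler f x0 d j)|
  <= L * M * (m%:R * d) ^+ 2.
Proof.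
move=> tm d0; have [M0 L0 fM fL] := tm.
elim: m => [|m IH] kr.
  by rewrite addn0 subrr !mul0r scale0r subrr normr0 expr0n mulr0.
have dM : 0 <= d * M by rewrite mulr_ge0// ltW.
have kr' : (j + m)%:R * d * M <= r by move: kr; rewrite addnS -natr1; lra.
have jr : j%:R * d * M <= r.
  by apply: le_trans kr'; rewrite -!mulrA ler_wpM2r// ler_nat leq_addr.
have {IH} Hk := IH kr'.
rewrite addnS /= -/(euler f x0 d _).
set y := euler f x0 d (j + m); set z := euler f x0 d j.
have -> : y + d *: f y - z - (m.+1%:R * d) *: f z =
    (y - z - (m%:R * d) *: f z) + d *: (f y - f z).
  rewrite -natr1 mulrDl mul1r scalerDl scalerBr opprD !addrA.
  by do 2!rewrite (addrAC _ (d *: f y)).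
rewrite (le_trans (ler_normD _ _))// normrZ (gtr0_norm d0).
have Hyz : `|f y - f z| <= L * (m%:R * d * M).
  apply: (le_trans (fL _ _ _ _)).
  - exact: le_trans (euler_ball tm d0 kr') kr'.
  - exact: le_trans (euler_ball tm d0 jr) jr.
  - by rewrite ler_wpM2l// (euler_lipschitz tm d0).
have LM : 0 <= L * M by rewrite mulr_ge0.
have := ler_wpM2l (ltW d0) Hyz.
(* The induction leaves a slack of [m + 1] copies of [L * M * d ^+ 2], since
   [(m + 1) ^+ 2 - m ^+ 2 - m = m + 1]; both parts are stated as nonnegative for the linear
   solver. *)
have : 0 <= L * M * (d * d) by rewrite mulr_ge0// mulr_ge0// ltW.
have : 0 <= m%:R * (L * M * (d * d)) by rewrite mulr_ge0// mulr_ge0// mulr_ge0// ltW.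
move: Hk; rewrite -/y -/z -natr1 !expr2; lra.
Qed.

(** The interpolation is piecewise constant rather than affine: estimates at arbitrary times reduce
    to the nodes, at the cost of one step [d]. *)
Definition euler_step (R : realType) (V : normedModType R) (f : V -> V)
  (x0 : V) (d t : R) : V := euler f x0 d (Num.truncn (t / d)).

Lemma euler_step_tangent (R : realType) (V : normedModType R) (f : V -> V)
    (x0 : V) (r M L d s t : R) (x := euler_step f x0 d) :
  tame_on_ball f x0 r M L -> 0 < d -> 0 <= s -> s <= t -> t * M <= r ->
  [/\ `|x s - x0| <= r, `|x t - x s| <= (t - s + d) * M &
    `|x t - x s - (t - s) *: f (x s)| <= L * M * (t - s + d) ^+ 2 + d * M].
Proof.
move=> tm d0 s0 st tr; have [M0 L0 fM fL] := tm.
have sd0 : 0 <= s / d by rewrite divr_ge0// ltW.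
have td0 : 0 <= t / d by rewrite divr_ge0 ?(le_trans s0 st)// ltW.
rewrite /x /euler_step.
have := truncn_itv sd0; have := truncn_itv td0.
set k := Num.truncn (t / d); set j := Num.truncn (s / d).
rewrite !ler_pdivlMr// !ltr_pdivrMr// -!natr1 => /andP[k1 k2] /andP[j1 j2].
have jk : (j <= k)%N by rewrite le_truncn// ler_pM2r// invr_gt0.
have kr : k%:R * d * M <= r by rewrite (le_trans _ tr)// ler_wpM2r.
have jr : j%:R * d * M <= r.
  by rewrite (le_trans _ kr)// -!mulrA ler_wpM2r ?ler_nat// mulr_ge0// ltW.
have jmr : (j + (k - j))%:R * d * M <= r by rewrite subnKC.
have e1 := euler_lipschitz tm d0 jmr.
have e2 := euler_tangent tm d0 jmr.
have bs := le_trans (euler_ball tm d0 jr) jr.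
rewrite !subnKC// natrB// in e1 e2.
set y := euler f x0 d k in e1 e2 *; set z := euler f x0 d j in e1 e2 bs *.
have md : (k%:R - j%:R) * d <= t - s + d by lra.
have md0 : 0 <= (k%:R - j%:R) * d.
  by apply: mulr_ge0; [rewrite subr_ge0 ler_nat|exact: ltW].
split=> //; first by rewrite (le_trans e1)// ler_wpM2r.
(* The error is that of the nodes plus a time mismatch of at most [d], travelled at speed at most
   [M]. *)
have -> : y - z - (t - s) *: f z = (y - z - ((k%:R - j%:R) * d) *: f z)
    + ((k%:R - j%:R) * d - (t - s)) *: f z.
  by rewrite [X in _ = _ + X]scalerBl addrA subrK.
rewrite (le_trans (ler_normD _ _))// lerD//.
  by rewrite (le_trans e2)// ler_wpM2l ?mulr_ge0// ler_sqr ?nnegrE// (le_trans md0).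
rewrite normrZ ler_pM// ?fM// ler_norml; apply/andP; split; lra.
Qed.

(** * Passage to the limit of vanishing step *)

(** Compactness gives a cluster point [p]. An ultrafilter contains the preimage of each
    neighbourhood of [p] or its complement, and clustering at [p] excludes the complement. *)
Lemma ultra_cvg (T : Type) (U : set_system T) (X : topologicalType)
    (K : set X) (u : T -> X) :
  UltraFilter U -> compact K -> (forall i, K (u i)) ->
  exists2 p, K p & u @ U --> p.
Proof.
move=> UU Kc uK; have [//|p [Kp clp]] := Kc (u @ U) _.
  by apply: nearW => i; exact: uK.
exists p => // A Ap; have [//|UAC] := in_ultra_setVsetC (u @^-1` A) UU.
by have [q []] := clp (~` A) A UAC Ap.
Qed.

(* Limits are taken pointwise along a fixed ultrafilter, so that no
   equicontinuity argument is needed. *)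
Lemma exists_tangent_curve (R : realType) (n : nat)
    (f : 'rV[R]_n -> 'rV[R]_n) (x0 : 'rV[R]_n) (r M L : R) :
  0 < r -> continuous f -> tame_on_ball f x0 r M L ->
  exists2 x : R -> 'rV[R]_n, x 0 = x0 &
  forall s t, 0 <= s -> s <= t -> t * M <= r ->
  [/\ `|x s - x0| <= r, `|x t - x s| <= (t - s) * M &
    `|x t - x s - (t - s) *: f (x s)| <= L * M * (t - s) ^+ 2].
Proof.
move=> r0 fc tm.
(* [U] refines the filter of eventual properties, so the steps [i.+1%:R^-1] still tend to 0 along
   it. *)
have [U [UU sU]] := ultraFilterLemma (@eventually_filter).
have UP : ProperFilter U by exact: ultra_proper.
pose E (i : nat) : R -> 'rV[R]_n := euler_step f x0 (i.+1%:R^-1).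
have i0 (i : nat) : 0 < i.+1%:R^-1 :> R by rewrite invr_gt0 ltr0n.
pose K := closed_ball x0 r.
have Kc : compact K.
  apply: bounded_closed_compact; last exact: closed_ball_closed.
  exists (`|x0| + r); split=> [|B Br y]; first exact: num_real.
  rewrite /K closed_ballE// => /= yr; apply: le_trans (ltW Br).
  have := ler_distD x0 y 0; rewrite !subr0 => /le_trans; apply.
  by rewrite addrC lerD2l distrC.
have cvE t : 0 <= t -> t * M <= r -> exists p : 'rV[R]_n, E ^~ t @ U --> p.
  move=> t0 tr; have [] := ultra_cvg (u := E ^~ t) UU Kc;
    last by move=> p; exists p.
  move=> i; rewrite /K closed_ballE// /closed_ball_ /= distrC.
  by case: (euler_step_tangent tm (i0 i) t0 (lexx t) tr).
(* The value 0 is a placeholder at times where no limit is claimed. *)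
pose x t : 'rV[R]_n := if pselect (0 <= t /\ t * M <= r) is left h
  then projT1 (cid (cvE t h.1 h.2)) else 0.
have xE t : 0 <= t -> t * M <= r -> E ^~ t @ U --> x t.
  move=> t0 tr; rewrite /x; case: pselect => [h|[]//].
  exact: (projT2 (cid (cvE t h.1 h.2))).
have dU : (fun i : nat => i.+1%:R^-1 : R) @ U --> (0 : R).
  by move=> A /(cvg_harmonic (R := R)) /sU.
exists x.
  have := xE 0 (lexx _); rewrite mul0r => /(_ (ltW r0)) H.
  apply: (cvg_unique _ H) => //.
  rewrite /E /euler_step.
  have -> : (fun i : nat => euler f x0 i.+1%:R^-1 (Num.truncn (0 / i.+1%:R^-1 : R)))
    = fun=> x0 by apply/funext => i; rewrite mul0r truncn0.
  exact: cvg_cst.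
move=> s t s0 st tr.
have [M0 L0 _ _] := tm.
have sr : s * M <= r by rewrite (le_trans _ tr)// ler_wpM2r.
have Es := xE s s0 sr; have Et := xE t (le_trans s0 st) tr.
have H i := euler_step_tangent tm (i0 i) s0 st tr.
have tsd : (fun i : nat => t - s + i.+1%:R^-1 : R) @ U --> (t - s : R).
  by rewrite -[X in _ --> X]addr0; apply: cvgD => //; exact: cvg_cst.
split.
- apply: (@ler_cvg_to _ U _ _ (fun i => `|E i s - x0|) (fun=> r)).
  + by apply: cvg_norm; apply: cvgB => //; exact: cvg_cst.
  + exact: cvg_cst.
  + by apply: nearW => i; case: (H i).
- apply: (@ler_cvg_to _ U _ _ (fun i => `|E i t - E i s|)
      (fun i => (t - s + i.+1%:R^-1) * M)).
  + by apply: cvg_norm; apply: cvgB.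
  + by apply: cvgMr_tmp.
  + by apply: nearW => i; case: (H i).
- apply: (@ler_cvg_to _ U _ _
      (fun i => `|E i t - E i s - (t - s) *: f (E i s)|)
      (fun i => L * M * (t - s + i.+1%:R^-1) ^+ 2 + i.+1%:R^-1 * M)).
  + apply: cvg_norm; apply: cvgB; first exact: cvgB.
    by apply: cvgZl_tmp; apply: cvg_comp; [exact: Es|exact: fc].
  + rewrite -[X in _ --> X]addr0 -(mul0r M); apply: cvgD; last exact: cvgMr_tmp.
    by apply: cvgMl_tmp; rewrite expr2; apply: cvgM.
  + by apply: nearW => i; case: (H i).
Qed.

(** * Local existence of solutions *)

Lemma locally_lipschitz_tame (R : realType) (V : normedModType R) (f : V -> V)
    (x0 : V) :
  locally_lipschitz f ->
  exists r M L, [/\ 0 < r, 0 < M & tame_on_ball f x0 r M L].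
Proof.
move=> /(_ x0)[A /nbhs_ballP[e /= e0 eA] [L [_ Lf]]].
(* The Lipschitz inequality holds for every constant strictly above [L], and [L] may be negative. *)
pose K := Num.max 0 (L + 1).
have K0 : 0 <= K by rewrite le_max lexx.
have Kf u v : A u -> A v -> `|f u - f v| <= K * `|u - v|.
  by move=> Au Av; apply: (Lf K _ (u, v)) => //; rewrite lt_max ltrDl ltr01 orbT.
have inA u : `|u - x0| <= e / 2 -> A u.
  move=> ue; apply: eA; rewrite -ball_normE /= distrC.
  by rewrite (le_lt_trans ue)// ltr_pdivrMr// ltr_pMr// ltr1n.
have e20 : 0 < e / 2 by rewrite divr_gt0.
have Ax0 : A x0 by apply: inA; rewrite subrr normr0 ltW.
(* The final [+ 1] makes [M] positive, so that the lifespan [r / M] makes sense. *)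
exists (e / 2), (`|f x0| + K * (e / 2) + 1), K.
have M0 : 0 < `|f x0| + K * (e / 2) + 1.
  by rewrite ltr_pwDr// addr_ge0// mulr_ge0// ltW.
split=> //; split; [exact: ltW|exact: K0| |].
- move=> u ue; rewrite -[f u](subrK (f x0)) addrC (le_trans (ler_normD _ _))//.
  rewrite -addrA lerD2l (le_trans (Kf _ _ (inA _ ue) Ax0))//.
  by rewrite (le_trans (ler_wpM2l K0 ue))// lerDl.
- by move=> u v ue ve; apply: Kf; exact: inA.
Qed.

Lemma locally_lipschitz_continuous (R : realType) (V : normedModType R)
    (f : V -> V) : locally_lipschitz f -> continuous f.
Proof.
move=> fl x; have [r [M [L [r0 _ [_ L0 _ fL]]]]] := locally_lipschitz_tame x fl.
apply/cvgrPdist_le => e e0; near=> y.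
have yr : `|x - y| <= r.
  by near: y; have /cvgrPdist_le := @cvg_id _ (nbhs x); apply.
have ye : `|x - y| <= e / (L + 1).
  near: y; have /cvgrPdist_le := @cvg_id _ (nbhs x); apply.
  by rewrite divr_gt0// ltr_wpDl.
have xx : `|x - x| <= r by rewrite subrr normr0 ltW.
rewrite distrC in yr; rewrite (le_trans (fL _ _ xx yr))//.
rewrite (le_trans (ler_wpM2l L0 ye))// mulrA ler_pdivrMr ?ltr_wpDl//.
by rewrite mulrDr mulr1 mulrC lerDl ltW.
Unshelve. all: by end_near. Qed.

(** Dividing a quadratic remainder by the increment leaves an error of order [q]. The general filter
    covers both the right derivative at the initial time and two-sided derivatives later. *)
Lemma difference_quotient_cvg (R : realType) (V : normedModType R) (T : Type)
    (F : set_system T) {FF : Filter F} (q : T -> R) (y : T -> V) (v : V) (K : R) :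
  0 <= K -> q @ F --> (0 : R) -> (\forall i \near F, q i != 0) ->
  (\forall i \near F, `|y i - q i *: v| <= K * q i ^+ 2) ->
  (fun i => (q i)^-1 *: y i) @ F --> v.
Proof.
move=> K0 q0 qn0 yv; apply/cvgrPdist_le => e e0; near=> i.
have qi0 : q i != 0 by near: i.
have qe : `|q i| <= e / (K + 1).
  rewrite -[q i]opprK normrN -[- q i]add0r; near: i.
  by move/cvgrPdist_le : q0; apply; rewrite divr_gt0// ltr_wpDl.
have yq : `|y i - q i *: v| <= K * q i ^+ 2 by near: i.
have -> : v - (q i)^-1 *: y i = - ((q i)^-1 *: (y i - q i *: v)).
  by rewrite scalerBr scalerA mulVf// scale1r opprB.
rewrite normrN normrZ normfV ler_pdivrMl ?normr_gt0//.
rewrite (le_trans yq)// -real_normK ?num_real// expr2 mulrCA ler_wpM2l//.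
rewrite (le_trans (ler_wpM2l K0 qe))// mulrA ler_pdivrMr ?ltr_wpDl//.
by rewrite mulrDr mulr1 mulrC lerDl ltW.
Unshelve. all: by end_near. Qed.

Lemma exists_local_solution (R : realType) (n : nat)
    (f : 'rV[R]_n -> 'rV[R]_n) (t0 : R) (x0 : 'rV[R]_n) :
  locally_lipschitz f -> exists tau x, solution_on f t0 x0 tau x.
Proof.
move=> fl; have fc := locally_lipschitz_continuous fl.
have [r [M [L [r0 M0 tm]]]] := locally_lipschitz_tame x0 fl.
have [x x00 H] := exists_tangent_curve r0 fc tm.
have [_ L0 _ fL] := tm.
have LM : 0 <= L * M by rewrite mulr_ge0// ltW.
exists (t0 + r / M)%:E, (fun t => x (t - t0)); split.
- by rewrite lte_fin ltrDl divr_gt0.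
- by rewrite subrr.
- rewrite subrr x00; apply: (difference_quotient_cvg (K := L * M)) => //.
  + rewrite -(subrr t0); apply: cvgB; last exact: cvg_cst.
    by apply: cvg_within_filter; exact: cvg_id.
  + by near=> t; rewrite subr_eq0; near: t; exact: nbhs_right_neq.
  + near=> t; have tt0 : t0 < t by near: t; exact: nbhs_right_gt.
    have [||_ _] := H 0 (t - t0) (lexx _).
    * by rewrite subr_ge0 ltW.
    * rewrite -ler_pdivlMr// ltW//; near: t; apply: nbhs_right_ltDr.
      by rewrite divr_gt0.
    * by rewrite subr0 x00.
move=> t t0t; rewrite lte_fin => tr.
have cv : (fun k : R => k^-1 *: (((fun t => x (t - t0)) \o shift t) (k *: 1) -
    x (t - t0))) @ 0^' --> f (x (t - t0)).
  have d0 : 0 < Num.min (t - t0) (t0 + r / M - t).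
    by rewrite lt_min; apply/andP; split; lra.
  (* One [L * M] suffices for forward increments. For backward ones the tangent estimate is based at
     the earlier point, and moving [f] back to the later point costs a second [L * M]. *)
  apply: (difference_quotient_cvg (K := L * M + L * M)); first by rewrite addr_ge0.
  - by apply: cvg_within_filter; exact: cvg_id.
  - exact: nbhs_dnbhs_neq.
  near=> k => /=; rewrite /GRing.scale /= mulr1.
  have : `|k| < Num.min (t - t0) (t0 + r / M - t) by near: k; exact: dnbhs0_lt.
  rewrite lt_min => /andP[]; rewrite !ltr_norml => /andP[k1 k2] /andP[k3 k4].
  have tM : (t - t0) * M <= r by rewrite -ler_pdivlMr//; lra.
  have tkM : (k + t - t0) * M <= r by rewrite -ler_pdivlMr//; lra.
  have [k0|k0] := leP 0 k.
    have [||//|_ _] := H (t - t0) (k + t - t0); [lra|lra|].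
    have -> : k + t - t0 - (t - t0) = k by lra.
    move=> /le_trans; apply.
    by rewrite ler_wpM2r// ?sqr_ge0// lerDl.
  have [||//|b0 b1 b2] := H (k + t - t0) (t - t0); [lra|lra|].
  (* Equal times are used only to place [w] in the ball. *)
  have [||//|b3 _ _] := H (t - t0) (t - t0); [lra|lra|].
  have kE : t - t0 - (k + t - t0) = - k by lra.
  rewrite {}kE sqrrN in b1 b2.
  set u := x (k + t - t0) in b0 b1 b2 *; set w := x (t - t0) in b1 b2 b3 *.
  have -> : u - w - k *: f w = k *: (f u - f w) - (w - u - (- k) *: f u).
    rewrite scaleNr opprK opprD opprB scalerBr.
    by rewrite [RHS]addrC addrA subrK.
  rewrite (le_trans (ler_normB _ _))// mulrDl lerD//.
  rewrite normrZ (ltr0_norm k0).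
  have nk : 0 <= - k by lra.
  rewrite distrC in b1.
  have := ler_wpM2l nk (le_trans (fL _ _ b0 b3) (ler_wpM2l L0 b1)).
  by rewrite expr2; lra.
by split; [apply/cvg_ex; exists (f (x (t - t0)))|exact: cvg_lim].
Unshelve. all: by end_near. Qed.

(** * Extension to a maximal solution *)

Lemma near_lte_fin (R : realType) (t : R) (tau : \bar R) :
  (t%:E < tau)%E -> \forall s \near t, (s%:E < tau)%E.
Proof.
case: tau => [r| |] //; last first.
  by move=> _; apply: (@filterE _ (nbhs t)) => s; rewrite ltry.
by rewrite lte_fin => tr; apply: filterS (lt_nbhsl tr) => s; rewrite lte_fin.
Qed.

(** Zorn's lemma is applied to a preorder: values outside the interval are arbitrary, so mutual
    extension does not imply equality. A nonempty chain is bounded by gluing its members up to the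
    supremum of their end times. *)
Lemma exists_maximal_solution (R : realType) (n : nat)
    (f : 'rV[R]_n -> 'rV[R]_n) (t0 : R) (x0 : 'rV[R]_n) :
  (exists tau x, solution_on f t0 x0 tau x) ->
  exists tau x, maximal_solution f t0 x0 tau x.
Proof.
move=> [tau0 [y0 sol0]].
pose P := {p : \bar R * (R -> 'rV[R]_n) | solution_on f t0 x0 p.1 p.2}.
pose ext (a b : P) := ((sval a).1 <= (sval b).1)%E /\
  forall t, t0 <= t -> (t%:E < (sval a).1)%E -> (sval b).2 t = (sval a).2 t.
pose p0 : P := exist _ (tau0, y0) sol0.
have [||A Atot|[[tau y] /= soly] ymax] := @ZL_preorder P p0 (fun a b => `[< ext a b >]).
- by move=> a; apply/asboolP; split.
- move=> b a c /asboolP[ab1 ab2] /asboolP[bc1 bc2]; apply/asboolP; split.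
    exact: le_trans bc1.
  by move=> t t0t ta; rewrite bc2 ?ab2//; exact: lt_le_trans ab1.
- have [[a0 Aa0]|A0] := pselect (exists a, A a); last first.
    by exists p0 => s As; exfalso; apply: A0; exists s.
  pose tau := ereal_sup [set (sval a).1 | a in A].
  pose Q t (a : P) := A a /\ (t%:E < (sval a).1)%E.
  (* Any member of the chain living past [t] may be chosen, since totality of the chain makes them
     agree at [t]. *)
  pose y t := if pselect (exists a, Q t a) is left h
    then (sval (projT1 (cid h))).2 t else 0.
  have yE a t : A a -> t0 <= t -> (t%:E < (sval a).1)%E -> y t = (sval a).2 t.
    move=> Aa t0t ta; rewrite /y; case: pselect => [h|[]]; last by exists a.
    case: (projT2 (cid h)) => Ab tb; set b := projT1 (cid h) in Ab tb *.
    by have [/asboolP[_ ->]|/asboolP[_ ->]] := Atot _ _ Aa Ab.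
  have tau_ge a : A a -> ((sval a).1 <= tau)%E.
    by move=> Aa; apply: ereal_sup_ubound; exists a.
  have soly : solution_on f t0 x0 tau y.
    have [lt0 y0E dy0 _] := svalP a0.
    split.
    + exact: lt_le_trans (tau_ge _ Aa0).
    + by rewrite (yE a0).
    + rewrite (yE a0 t0)//; apply: cvg_trans dy0; apply: near_eq_cvg; near=> t.
      have t0t : t0 < t by near: t; exact: nbhs_right_gt.
      rewrite (yE a0) ?ltW//.
      by near: t; apply: cvg_within; exact: near_lte_fin.
    (* Below the supremum some member lives past [t] and coincides with [y] near [t], so it
       transmits its derivative. *)
    + move=> t t0t /ereal_sup_gt[_ [a Aa <-] ta].
      have [_ _ _ /(_ t t0t ta)] := svalP a.
      rewrite -(yE a t) ?ltW//; apply: near_eq_is_derive.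
      near=> s; rewrite (yE a)//.
        by apply: ltW; near: s; exact: lt_nbhsr.
      by near: s; exact: near_lte_fin.
  exists (exist _ (tau, y) soly) => a Aa; apply/asboolP; split => /=.
    exact: tau_ge.
  by move=> t t0t ta; exact: yE.
exists tau, y; split=> // tau' z solz zy.
have /orP[//|tt'] := le_total tau' tau.
pose c : P := exist _ (tau', z) solz.
by have /asboolP[ctau _] := ymax c (asboolT (conj tt' zy)); exact: ctau.
Unshelve. all: by end_near. Qed.

(** * The Lie derivative on the zero set, and conclusion *)

(** To first order [h (x t)] is [(t - t0) * D (q t)], where the quotient [q t] tends to [v = f x0];
    a negative [D v] would make [h (x t)] negative just after [t0]. *)
Lemma lie_derivative_boundary (R : realType) (n : nat)
    (f : 'rV[R]_n -> 'rV[R]_n) (h : 'rV[R]_n -> R) (t0 : R) (x0 : 'rV[R]_n)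
    (tau : \bar R) (x : R -> 'rV[R]_n) :
  differentiable h x0 -> h x0 = 0 -> solution_on f t0 x0 tau x ->
  (forall t, t0 <= t -> (t%:E < tau)%E -> 0 <= h (x t)) ->
  0 <= lie_derivative f h x0.
Proof.
move=> dh h0 [t0tau x0E dx _] hx; rewrite leNgt; apply/negP => Lneg.
move: Lneg; rewrite /lie_derivative; set v := f x0 => Lneg.
rewrite x0E in dx.
pose w t := x t - x0; pose q t := (t - t0)^-1 *: w t.
have qv : q t @[t --> t0^'+] --> v := dx.
have tt0 : (t - t0) @[t --> t0^'+] --> 0.
  rewrite -(subrr t0); apply: cvgB; last exact: cvg_cst.
  by apply: cvg_within_filter; exact: cvg_id.
have w0 : w t @[t --> t0^'+] --> (0 : 'rV[R]_n).
  rewrite -(scale0r v); apply: cvg_trans (cvgZ tt0 qv).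
  apply: near_eq_cvg; near=> t; rewrite /q scalerA divff ?scale1r//.
  by rewrite subr_eq0; near: t; exact: nbhs_right_neq.
pose D : 'rV[R]_n -> R := 'd h x0.
have Dv : D v < 0 := Lneg.
have Dc : continuous D by exact: diff_continuous.
(* Eventually [D (q t) < D v / 2] and [|q t| < |v| + 1]; this [e] keeps the remainder below
   [- D v / 4], so the sum stays negative. *)
pose e := - D v / 4 / (`|v| + 1).
have v1 : 0 < `|v| + 1 by rewrite ltr_wpDl.
have e0 : 0 < e by rewrite !divr_gt0// oppr_gt0.
have o_small : \forall u \near (0 : 'rV[R]_n),
    `|h (u + x0) - h x0 - D u| <= e * `|u|.
  have /eqaddoP/(_ e e0) := diff_locally dh.
  by apply: filterS => u; rewrite /= !fctE /= opprD addrA.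
near t0^'+ => t.
have t0t : t0 < t by near: t; exact: nbhs_right_gt.
have d0 : 0 < t - t0 by rewrite subr_gt0.
have ttau : (t%:E < tau)%E.
  by near: t; apply: cvg_within; exact: near_lte_fin.
have wo : `|h (w t + x0) - h x0 - D (w t)| <= e * `|w t|.
  by near: t; exact: (w0 _ o_small).
have Dq : D (q t) < D v / 2.
  near: t; apply: (cvgr_lt (D v)); first exact: (cvg_comp _ _ qv (Dc v)).
  by lra.
have nq : `|q t| < `|v| + 1.
  by near: t; apply: (cvgr_lt `|v|); [exact: cvg_norm|rewrite ltrDl].
have wE : w t = (t - t0) *: q t by rewrite scalerA divff ?scale1r// gt_eqF.
have DZ : D (w t) = (t - t0) * D (q t) by rewrite wE [LHS]linearZ.
have ev : e * (`|v| + 1) = - D v / 4 by rewrite divfK// gt_eqF.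
move: wo; rewrite subrK h0 subr0 DZ wE normrZ gtr0_norm// => /ler_normlW wo.
have := hx t (ltW t0t) ttau.
have : (t - t0) * (D (q t) + e * `|q t|) < 0.
  rewrite pmulr_rlt0//.
  have : e * `|q t| < - D v / 4 by rewrite -ev ltr_pM2l.
  by lra.
by lra.
Unshelve. all: by end_near. Qed.

(** The direction [f x] moves with [x], whereas continuity of the differential is given for fixed
    directions; expanding [f x] in the canonical basis bridges the two. *)
Lemma lie_derivative_continuous (R : realType) (n : nat)
    (f : 'rV[R]_n -> 'rV[R]_n) (h : 'rV[R]_n -> R) :
  continuous f -> continuously_differentiable h ->
  continuous (lie_derivative f h).
Proof.
move=> fc [_ dhc].
have -> : lie_derivative f h = (fun x => \sum_(i < n) f x 0 i * 'd h x 'e_i).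
  apply/funext => x; rewrite /lie_derivative {1}(row_sum_delta (f x)) linear_sum.
  by apply: eq_bigr => i _; rewrite linearZ.
apply: continuous_big => [|i _ x]; first exact: add_continuous.
apply: (@continuousM _ _ (fun x => f x 0 i) (fun x => 'd h x 'e_i)); last exact: dhc.
by apply: (@continuous_comp _ _ _ f (fun M : 'rV[R]_n => M 0 i));
  [exact: fc|exact: coord_continuous].
Qed.

Theorem proposition3 (R : realType) (n : nat)
    (f : 'rV[R]_n -> 'rV[R]_n) (h : 'rV[R]_n -> R) (C : set 'rV[R]_n)
    (t0 : R)
    (f_lip : locally_lipschitz f)
    (h_C1 : continuously_differentiable h)
    (C_nonempty : C !=set0)
    (C_compact : compact C)
    (C_def : C = [set x | 0 <= h x])
    (C_boundary : boundary C = [set x | h x = 0])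
    (C_interior : C° = [set x | 0 < h x])
    (C_invariant : forward_invariant f t0 C) :
  zeroing_barrier_function f h C C.
Proof.
have [dh _] := h_C1.
have h0 x : C x -> 0 <= h x by rewrite C_def.
have hc : continuous h by move=> x; exact: differentiable_continuous.
have Lc := lie_derivative_continuous (locally_lipschitz_continuous f_lip) h_C1.
have L0 x : C x -> h x = 0 -> - lie_derivative f h x <= 0.
  move=> Cx hx0; rewrite oppr_le0.
  (* Invariance constrains maximal solutions only, so one starting at [x] has to be produced before
     it yields anything. *)
  have [tau [y ymax]] :=
    exists_maximal_solution (exists_local_solution t0 x f_lip).
  have [ysol _] := ymax.
  apply: (lie_derivative_boundary (dh x) hx0 ysol) => t t0t ttau.
  exact: h0 (C_invariant x Cx tau y ymax t t0t ttau).
have NLc : continuous (fun x => - lie_derivative f h x).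
  by move=> x; exact: continuousN (Lc x).
have [alpha Kalpha alphaP] := class_K_majorant C_compact hc NLc h0 L0.
split=> //; exists +oo%E, +oo%E, alpha; split=> // x Cx; split.
  by split; rewrite /= ?ltNyr ?ltry.
by rewrite lerNl; exact: alphaP.
Qed.
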